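(* Let $x$ be a context, $z\in\mathcal Z(x)$ a feasible decision, and $\nu=\sum_{k=1}^K w_k\delta_{\gamma_k}$ an aggregation rule, with conformal sets $\mathcal C_{\gamma_k}(x)$, shells $\mathcal A_j(x)$, nonempty-shell index set $\mathcal J(x)$, shell penalties $h_j$ and regional losses $L_j(z;x)$ as defined in the context. Assume that $L_j(z;x)<+\infty$ for every feasible $(z,x)$ and every $j\in\mathcal J(x)$. Then $$\mathcal R_{\alpha,\nu,x}\bigl(c(z,\cdot)\bigr)=\max\left\{\sum_{j\in\mathcal J(x)}p_jL_j(z;x)\ :\ p_j\ge 0\ (j\in\mathcal J(x)),\ \sum_{j\in\mathcal J(x)}p_j=1,\ \sum_{j\in\mathcal J(x)}h_jp_j\le\frac1\alpha\right\}.$$ Moreover, an optimal vector $(p_j)_{j\in\mathcal J(x)}$ for this linear program can be chosen with at most two positive components. If the suprema defining the $L_j(z;x)$ are attained, then there exists a worst-case probability law (i.e. a $\mathbb Q\in\mathfrak U_\alpha^\nu(x)$ attaining the supremum defining $\mathcal R_{\alpha,\nu,x}(c(z,\cdot))$) supported on at most two outcome points, one in each active shell (each shell with $p_j>0$). Without attainment, the same statement holds for $\varepsilon$-optimal laws for every $\varepsilon>0$: there is a law in $\mathfrak U_\alpha^\nu(x)$ supported on at most two outcome points, one in each active shell, whose expected cost is at least $\mathcal R_{\alpha,\nu,x}(c(z,\cdot))-\varepsilon$.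
   Context: Setting. $\mathcal X,\mathcal Y$ are standard Borel spaces; $\mathcal P(\mathcal Y)$ is the set of probability measures on $\mathcal Y$; $\mathcal Z(x)$ is the feasible decision set at context $x$; $c(z,y)$ is a real-valued cost with $c(z,\cdot)$ measurable. $\alpha\in(0,1)$. The calibration sample $\mathcal D_n=(X_i,Y_i)_{i=1}^n$ in $\mathcal X\times\mathcal Y$ is fixed. Conformal sets. For a measurable score $s:\mathcal X\times\mathcal Y\to\mathbb R$ put $S_i=s(X_i,Y_i)$; for $\gamma\in(0,1)$ let $k_\gamma=\lceil(n+1)(1-\gamma)\rceil$, let $\widehat q_{1-\gamma}$ be the $k_\gamma$-th smallest value among $S_1,\dots,S_n$ ($+\infty$ if $k_\gamma=n+1$), and $\mathcal C_\gamma(x)=\{y\in\mathcal Y:s(x,y)\le\widehat q_{1-\gamma}\}$. These sets are nested: $\gamma\le\gamma'$ implies $\mathcal C_\gamma(x)\supseteq\mathcal C_{\gamma'}(x)$. Aggregation rule. $\Gamma\subset(0,\alpha)$, and $\nu=\sum_{k=1}^Kw_k\delta_{\gamma_k}$ with $\gamma_k\in\Gamma$, $w_k\ge0$, $\sum_kw_k=1$. After removing zero-weight and duplicate support points the levels are ordered as $0<\gamma_1<\cdots<\gamma_K<\alpha$ (with $w_k>0$). It is assumed throughout that the innermost conformal region $\mathcal C_{\gamma_K}(x)$ is nonempty for every context $x$. Ambiguity set and robust risk. $$\mathfrak U_\alpha^\nu(x)=\left\{\mathbb Q\in\mathcal P(\mathcal Y):\ \sum_{k=1}^K\frac{w_k}{\gamma_k}\bigl(1-\mathbb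 Q(\mathcal C_{\gamma_k}(x))\bigr)\le\frac1\alpha\right\},\qquad \mathcal R_{\alpha,\nu,x}(c(z,\cdot))=\sup_{\mathbb Q\in\mathfrak U_\alpha^\nu(x)}\int_{\mathcal Y}c(z,y)\,\mathbb Q(\mathrm dy).$$ Shells. $\mathcal A_0(x)=\mathcal C_{\gamma_K}(x)$; $\mathcal A_j(x)=\mathcal C_{\gamma_{K-j}}(x)\setminus\mathcal C_{\gamma_{K-j+1}}(x)$ for $1\le j\le K-1$; $\mathcal A_K(x)=\mathcal Y\setminus\mathcal C_{\gamma_1}(x)$. Some shells may be empty; $\mathcal J(x)=\{j\in\{0,\ldots,K\}:\mathcal A_j(x)\ne\varnothing\}$. Penalties: $h_0=0$ and $h_j=\sum_{k=K-j+1}^K w_k/\gamma_k$ for $j=1,\ldots,K$. Regional losses: $L_j(z;x)=\sup_{y\in\mathcal A_j(x)}c(z,y)$ for $j\in\mathcal J(x)$. *)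

(* Defs.v *)
From mathcomp Require Export all_boot all_order all_algebra.
From mathcomp Require Export all_classical all_reals all_analysis.

Set Implicit Arguments.
Unset Strict Implicit.
Unset Printing Implicit Defensive.

Import Order.TTheory GRing.Theory Num.Theory.
Import numFieldNormedType.Exports.
Local Open Scope classical_set_scope.
Local Open Scope ring_scope.

(* T is measurably isomorphic to a Polish space with its Borel sets.  A
   pseudometric space that is Hausdorff is a metric space, so M is a separable
   complete metric space; M (hence T) is nonempty, as every measurableType is
   pointed. *)
Definition standard_borel (R : realType) d (T : measurableType d) : Prop :=
  exists (M : completePseudoMetricType R) (f : T -> M),
    [/\ hausdorff_space M,
        exists2 D : set M, countable D & dense D,
        bijective f
      & forall A : set T, measurable A <-> <<s [set U : set M | open U] >> (f @` A)].

Definition is_maximum (R : realType) (S : set (\bar R)) (m : \bar R) : Prop :=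
  S m /\ ubound S m.

Section ConformalSets.
Context {R : realType} {X Y : Type} {n : nat}.
Variables (s : X * Y -> R) (D : n.-tuple (X * Y)).

(* The ceiling is positive when 0 < g < 1, so the absolute value only changes
   the type from int to nat. *)
Definition conformal_rank (g : R) : nat :=
  `|Num.ceil (n.+1%:R * (1 - g))|%N.

(* The k-th smallest score is entry k - 1 of the sorted list of scores. *)
Definition conformal_quantile (g : R) : \bar R :=
  if (conformal_rank g <= n)%N
  then (nth 0 (sort <=%R [seq s d | d <- D]) (conformal_rank g).-1)%:E
  else +oo%E.

Definition conformal_set (g : R) (x : X) : set Y :=
  [set y | ((s (x, y))%:E <= conformal_quantile g)%E].

Definition conformal_region (gamma : nat -> R) (x : X) (k : nat) : set Y :=
  conformal_set (gamma k) x.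

End ConformalSets.

(* Levels and weights are indexed by k = 1, ..., K as in the usual notation;
   the values of gamma and w outside this range are never used.  The rule is
   in reduced form: positive weights, strictly increasing levels. *)
Definition aggregation_rule (R : realType) (Gamma : set R) (K : nat)
    (gamma w : nat -> R) : Prop :=
  [/\ forall k, (1 <= k <= K)%N -> Gamma (gamma k),
      forall k, (1 <= k < K)%N -> gamma k < gamma k.+1,
      forall k, (1 <= k <= K)%N -> 0 < w k
    & \sum_(1 <= k < K.+1) w k = 1].

Section RobustRisk.
Context {R : realType} {d : measure_display} {Y : measurableType d}.
Variables (alpha : R) (K : nat) (gamma w : nat -> R).
(* C k stands for the conformal set of level gamma k at a fixed context. *)
Variable C : nat -> set Y.

Definition ambiguity_set : set (probability Y R) :=
  [set Q : probability Y R |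
    (\sum_(1 <= k < K.+1) (w k / gamma k)%:E * (1 - Q (C k))
      <= (1 / alpha)%:E)%E].

Definition expected_cost (f : Y -> R) (Q : probability Y R) : \bar R :=
  (\int[Q]_y (f y)%:E)%E.

Definition robust_risk (f : Y -> R) : \bar R :=
  ereal_sup [set expected_cost f Q | Q in ambiguity_set].

Definition shell (j : nat) : set Y :=
  if j == 0%N then C K
  else if j == K then ~` C 1%N
  else C (K - j)%N `\` C (K - j + 1)%N.

Definition nonempty_shell : {pred 'I_K.+1} := fun j => `[< shell j !=set0 >].

Definition penalty (j : nat) : R :=
  \sum_(K - j + 1 <= k < K.+1) w k / gamma k.

Definition regional_loss (f : Y -> R) (j : nat) : \bar R :=
  ereal_sup [set (f y)%:E | y in shell j].

(* Only the components p j with j a nonempty shell index matter. *)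
Definition lp_feasible (p : 'I_K.+1 -> R) : Prop :=
  [/\ forall j, j \in nonempty_shell -> 0 <= p j,
      \sum_(j in nonempty_shell) p j = 1
    & \sum_(j in nonempty_shell) penalty j * p j <= 1 / alpha].

Definition lp_objective (f : Y -> R) (p : 'I_K.+1 -> R) : \bar R :=
  (\sum_(j in nonempty_shell) (p j)%:E * regional_loss f j)%E.

Definition lp_optimal (f : Y -> R) (p : 'I_K.+1 -> R) : Prop :=
  lp_feasible p /\
  forall q, lp_feasible q -> (lp_objective f q <= lp_objective f p)%E.

Definition active_shell (p : 'I_K.+1 -> R) : {pred 'I_K.+1} :=
  fun j => (j \in nonempty_shell) && (0 < p j).

(* Q is carried by finitely many atoms y j, exactly one in each active shell;
   in particular Q has no more atoms than p has positive components. *)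
Definition one_outcome_per_active_shell (p : 'I_K.+1 -> R)
    (Q : probability Y R) : Prop :=
  exists y : 'I_K.+1 -> Y,
    [/\ forall j, j \in active_shell p -> shell j (y j),
        forall j, j \in active_shell p -> (0 < Q [set y j])%E
      & Q (y @` [set j | j \in active_shell p]) = 1%E].

Definition regional_losses_attained (f : Y -> R) : Prop :=
  forall j, j \in nonempty_shell ->
    exists2 y, shell j y & (f y)%:E = regional_loss f j.

End RobustRisk.

Arguments nonempty_shell {d Y} K C.
Arguments lp_feasible {R d Y} alpha K gamma w C p.
Arguments lp_objective {R d Y} K C f p.
Arguments lp_optimal {R d Y} alpha K gamma w C f p.
Arguments active_shell {R d Y} K C p.
Arguments one_outcome_per_active_shell {R d Y} K C p Q.

(* Main.v *)
Require Import Defs.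
From HB Require Import structures.
From mathcomp Require Import ring lra zify measurable_realfun.

Set Implicit Arguments.
Unset Strict Implicit.
Unset Printing Implicit Defensive.

Import Order.TTheory GRing.Theory Num.Theory.
Import numFieldNormedType.Exports.
Local Open Scope classical_set_scope.
Local Open Scope ring_scope.

(** Choosing a law Q amounts to choosing the masses of the shells, and then how
    each of these masses is spread inside its shell.  The ambiguity constraint sees the masses alone: the shells
    partition the outcome space, and exchanging the sum over levels with the
    sum over shells turns the weighted miscoverage of Q into the sum of the
    shell masses against the penalties ([weighted_miscoverage]).  So the mass
    vector of an admissible law is feasible for the linear program, and
    bounding the cost on each shell by its supremum bounds the expected cost by
    the objective ([expected_cost_le_shells]).  Conversely, for a feasible
    vector p, atoms of mass p j at points of the shells j form an admissible
    law ([law_of_selection]), and its expected cost comes as close to the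
    objective as the costs at the atoms come to the suprema.

    The linear program has a single constraint besides those defining the
    simplex, which is why two positive components are enough.  Its vertices are
    the unit masses on an index within the budget and the mixtures of an index
    within the budget with one above it that exhaust the budget.  A best vertex
    is optimal by weak duality: the inequalities saying that no vertex exceeds
    its value V are exactly what makes a nonnegative price lam exist with
    L k <= V + lam * (h k - B) for every k ([dual_price]), and averaging these
    bounds with any feasible weights gives at most V.  This also yields the
    existence of a maximum with no compactness argument.

    Conformal sets enter through two properties only: they are measurable, and
    they shrink as the level increases, because the rank of the order statistic
    that defines them decreases. *)

(** * A linear program over the simplex with one budget constraint *)

Lemma sum_two_points (R : realFieldType) (I : finType) (J : {pred I}) (i j : I)
    (t : R) (g : I -> R) : i \in J -> j \in J ->
  \sum_(k in J) ((k == i)%:R * (1 - t) + (k == j)%:R * t) * g k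
  = (1 - t) * g i + t * g j.
Proof.
have point (a : I) (u : R) : a \in J ->
    \sum_(k in J) (k == a)%:R * u * g k = u * g a.
  move=> aJ; rewrite (bigD1 a) //= eqxx mul1r big1 ?addr0 //.
  move=> k /andP[_ /negPf ->].
  by rewrite !mul0r.
move=> iJ jJ; under eq_bigr do rewrite mulrDl.
by rewrite big_split /= !point.
Qed.

Section Knapsack.
Context {R : realFieldType} {I : finType}.
Variables (J : {pred I}) (h L : I -> R) (B : R).

Definition feasible (p : I -> R) : Prop :=
  [/\ forall j, j \in J -> 0 <= p j, \sum_(j in J) p j = 1
    & \sum_(j in J) h j * p j <= B].

(** The share of j in the vertex spanned by i and j.  For h i <= B < h j it is
    the share that makes the mean of h equal to B; when j itself is within
    budget, the vertex is the unit mass on i. *)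
Definition vertex_weight (i j : I) : R :=
  if h j <= B then 0 else (B - h i) / (h j - h i).

Definition vertex_value (i j : I) : R :=
  (1 - vertex_weight i j) * L i + vertex_weight i j * L j.

Lemma vertex_weight_ge0_le1 i j : h i <= B -> 0 <= vertex_weight i j <= 1.
Proof.
rewrite /vertex_weight => hi; case: (leP (h j) B) => [_|hj].
  by rewrite lexx ler01.
have d : 0 < h j - h i by lra.
by rewrite divr_ge0 ?ler_pdivrMr //; lra.
Qed.

Lemma vertex_weight_budget i j : h i <= B ->
  (1 - vertex_weight i j) * h i + vertex_weight i j * h j <= B.
Proof.
rewrite /vertex_weight => hi; case: (leP (h j) B) => [_|hj]; first by lra.
rewrite le_eqVlt; apply/orP; left; apply/eqP; field.
by apply/eqP; lra.
Qed.

(** An index j above the budget asks for lam >= (L j - V) / (h j - B), and an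
    index i below it asks for lam <= (V - L i) / (B - h i).  These demands are
    compatible for each pair, because that is what it means for the vertex of
    i and j to have value at most V; hence the largest among 0 and the lower
    bounds on lam works. *)
Lemma dual_price (V : R) :
  (forall i j, i \in J -> j \in J -> h i <= B -> vertex_value i j <= V) ->
  exists2 lam : R, 0 <= lam
    & forall k, k \in J -> L k <= V + lam * (h k - B).
Proof.
move=> Vmax; pose lam := \big[Num.max/0]_(j in J | B < h j) ((L j - V) / (h j - B)).
have LV k : k \in J -> h k <= B -> L k <= V.
  move=> kJ hk; have := Vmax k k kJ kJ hk.
  by rewrite /vertex_value /vertex_weight hk; lra.
exists lam => [|k kJ]; first exact: bigmax_ge_id.
case: (ltgtP (h k) B) => hk; last first.
- by rewrite hk subrr mulr0 addr0 LV // hk.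
- have : (L k - V) / (h k - B) <= lam.
    by apply: (le_bigmax_cond 0 (fun j => (L j - V) / (h j - B))); rewrite kJ hk.
  by rewrite ler_pdivrMr; lra.
have : lam <= (V - L k) / (B - h k).
  apply: bigmax_le => [|j /andP[jJ hj]].
    by rewrite divr_ge0 ?subr_ge0 ?LV // ltW.
  have := Vmax k j kJ jJ (ltW hk).
  rewrite /vertex_value /vertex_weight (leNgt (h j)) hj /=.
  set t := (_ / _) => tV.
  have tE : t * (h j - h k) = B - h k by rewrite mulfVK //; apply/eqP; lra.
  rewrite ler_pdivrMr ?subr_gt0 // mulrAC ler_pdivlMr ?subr_gt0 //.
  have d : 0 <= h j - h k by lra.
  have := ler_wpM2r d tV.
  (* Clearing the denominator of t makes the comparison of slopes linear. *)
  have -> : ((1 - t) * L k + t * L j) * (h j - h k) =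
     (h j - h k) * L k + (t * (h j - h k)) * (L j - L k) by ring.
  by rewrite tE; lra.
by rewrite ler_pdivlMr ?subr_gt0 //; lra.
Qed.

(** The optimum is the best vertex, a maximum over finitely many pairs; the dual
    price certifies it against all feasible vectors at once. *)
Lemma knapsack_two_point_optimum (i0 : I) : i0 \in J -> h i0 <= B ->
  exists p : I -> R,
    [/\ feasible p,
        forall q, feasible q ->
          \sum_(j in J) q j * L j <= \sum_(j in J) p j * L j
      & (#|[pred j | (j \in J) && (0 < p j)%R]| <= 2)%N].
Proof.
move=> i0J hi0.
pose P := [pred u : I * I | [&& u.1 \in J, u.2 \in J & h u.1 <= B]].
have P0 : P (i0, i0) by rewrite /= i0J hi0.
have [[i j] /and3P[/= iJ jJ hi] Vmax] :=
  @arg_maxP _ _ _ (i0, i0) P (fun u => vertex_value u.1 u.2) P0.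
pose t := vertex_weight i j.
have [lam lam0 price] : exists2 lam : R, 0 <= lam
    & forall k, k \in J -> L k <= vertex_value i j + lam * (h k - B).
  by apply: dual_price => a b aJ bJ ha; apply: (Vmax (a, b)); rewrite /= aJ bJ.
have /andP[t0 t1] : 0 <= t <= 1 by exact: vertex_weight_ge0_le1.
exists (fun k => (k == i)%:R * (1 - t) + (k == j)%:R * t); split.
- split.
  + by move=> k _; rewrite addr_ge0 // mulr_ge0 // subr_ge0.
  + have := sum_two_points t (fun=> 1) iJ jJ.
    rewrite !mulr1 subrK; apply: etrans.
    by apply: eq_bigr => k _; rewrite mulr1.
  + under eq_bigr do rewrite mulrC.
    by rewrite sum_two_points //; exact: vertex_weight_budget.
- move=> q [q0 q1 qB]; rewrite sum_two_points // -/(vertex_value i j).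
  set V := vertex_value i j in price *.
  have : \sum_(k in J) q k * L k
         <= \sum_(k in J) (q k * (V - lam * B) + lam * (h k * q k)).
    apply: ler_sum => k kJ.
    have -> : q k * (V - lam * B) + lam * (h k * q k) =
              q k * (V + lam * (h k - B)) by ring.
    by apply: ler_wpM2l; [exact: q0|exact: price].
  rewrite big_split /= -mulr_suml q1 mul1r -mulr_sumr => /le_trans; apply.
  by have := ler_wpM2l lam0 qB; lra.
- apply: (@leq_trans #|pred2 i j|); last by rewrite card2; case: (i != j).
  apply: subset_leq_card; apply/fintype.subsetP => k; rewrite !inE => /andP[_].
  by case: (k == i) => //; case: (k == j) => //; rewrite !mul0r addr0 ltxx.
Qed.

End Knapsack.

(** * Integration against finitely supported laws *)

Section Laws.
Context {d : measure_display} {T : measurableType d} {R : realType}.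

(** A cost may be unbounded below, with expectation -oo.  Comparing positive
    and negative parts separately covers this case, because in the extended
    reals subtraction is monotone whatever its arguments. *)
Lemma le_integral_measurable (mu : {measure set T -> \bar R}) (f g : T -> R) :
  measurable_fun [set: T] f -> measurable_fun [set: T] g ->
  (forall x, f x <= g x) ->
  (\int[mu]_x (f x)%:E <= \int[mu]_x (g x)%:E)%E.
Proof.
move=> /measurable_EFinP mf /measurable_EFinP mg fg.
have fg' x : ((EFin \o f) x <= (EFin \o g) x)%E by rewrite lee_fin.
rewrite integralE [leRHS]integralE; apply: leeB.
- apply: ge0_le_integral => //; try exact: measurable_funepos.
  by move=> x _; apply: (@funepos_le _ _ setT) => [t _|]; [exact: fg'|rewrite inE].
- apply: ge0_le_integral => //; try exact: measurable_funeneg.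
  by move=> x _; apply: (@funeneg_le _ _ setT) => [t _|]; [exact: fg'|rewrite inE].
Qed.

(** The mass formula holds for every set A, measurable or not, since Dirac masses
    are defined on all sets; in particular it applies to sets of atoms. *)
Lemma finitely_supported_law (N : nat) (r : 'I_N.+1 -> R) (y : 'I_N.+1 -> T) :
  (forall i, 0 <= r i) -> \sum_i r i = 1 ->
  exists Q : probability T R,
    (forall A, Q A = (\sum_i r i * \1_A (y i))%:E) /\
    (forall f : T -> R, measurable_fun [set: T] f ->
       (\int[Q]_x (f x)%:E)%E = (\sum_i r i * f (y i))%:E).
Proof.
move=> r0 r1.
pose m (k : nat) : {measure set T -> \bar R} :=
  mscale (NngNum (r0 (inord k))) \d_(y (inord k)).
pose S : {measure set T -> \bar R} := msum m N.+1.
have SE A : S A = (\sum_i r i * \1_A (y i))%:E.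
  rewrite /S /= /msum -sumEFin; apply: eq_bigr => i _.
  by rewrite /m /= /mscale /= inord_val diracE indicE EFinM.
have ST : S setT = 1%E.
  rewrite SE; congr EFin; rewrite -r1.
  by apply: eq_bigr => i _; rewrite indicT mulr1.
pose Q : probability T R := HB.pack (msum m N.+1)
  (Measure_isProbability.Build _ _ _ (msum m N.+1) ST).
exists Q; split=> [A|f mf]; first exact: SE.
have int_ge0 (g : T -> \bar R) : (forall x, 0 <= g x)%E ->
    measurable_fun [set: T] g ->
    (\int[S]_x g x = \sum_(i < N.+1) (r i)%:E * g (y i))%E.
  move=> g0 mg; rewrite ge0_integral_measure_sum //; apply: eq_bigr => i _.
  rewrite ge0_integral_mscale // integral_dirac // diracT mul1e.
  by rewrite inord_val.
have mE : measurable_fun [set: T] (EFin \o f) by apply/measurable_EFinP.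
(* The law Q and the measure S are the same set function. *)
rewrite (_ : (\int[Q]_x _)%E = \int[S]_x (f x)%:E)%E //.
rewrite integralE !int_ge0 //;
  try by [exact: measurable_funepos|exact: measurable_funeneg].
have posE x : ((EFin \o f)^\+ x = (Num.max (f x) 0)%:E)%E.
  by rewrite funeposE EFin_max.
have negE x : ((EFin \o f)^\- x = (Num.max (- f x) 0)%:E)%E.
  by rewrite funenegE EFin_max.
under eq_bigr do rewrite posE -EFinM.
under [X in (_ - X)%E]eq_bigr do rewrite negE -EFinM.
rewrite !sumEFin -EFinB -sumrB; congr EFin; apply: eq_bigr => i _.
rewrite -mulrBr; congr (_ * _).
by case: (leP (f (y i)) 0) => fi; case: (leP (- f (y i)) 0) => fi'; lra.
Qed.
End Laws.

(** * Shells of a nested family *)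

Section Shells.
Context {d : measure_display} {Y : measurableType d} {R : realType}.
Variables (K : nat) (C : nat -> set Y).
Hypothesis K_gt0 : (0 < K)%N.
Hypothesis C_nested : forall k, (1 <= k < K)%N -> C k.+1 `<=` C k.
Hypothesis C_measurable : forall k, measurable (C k).

(** The union of the shells 0, ..., j.  The whole space plays the role of a set
    of index 0 in the family, so that each shell is a difference of consecutive
    unions and sums over shells telescope. *)
Definition shell_union (j : nat) : set Y :=
  if j == K then [set: Y] else C (K - j)%N.

Lemma shell0 : shell K C 0 = shell_union 0.
Proof. by rewrite /shell /shell_union eqxx subn0; case: eqP K_gt0 => // <-. Qed.

Lemma shellS (j : nat) : (j < K)%N ->
  shell K C j.+1 = shell_union j.+1 `\` shell_union j.
Proof.
move=> jK; rewrite /shell /shell_union (ltn_eqF jK) /=; case: eqP => [<-|_].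
  by rewrite subSnn setTD.
by rewrite addn1 -subSn // subSS.
Qed.

Lemma shell_union_nested (i j : nat) :
  (i <= j <= K)%N -> shell_union i `<=` shell_union j.
Proof.
move=> /andP[ij]; rewrite -(subnK ij).
elim: (j - i)%N => [|k IH]; first by move=> _ y; rewrite add0n.
rewrite addSn => kK; apply: (subset_trans (IH (ltnW kK))).
rewrite /shell_union (ltn_eqF kK); case: eqP => // ne.
have lt : ((k + i).+1 < K)%N by rewrite ltn_neqAle kK andbT; apply/eqP.
have := C_nested (k := (K - (k + i).+1)%N); rewrite -subSn // subSS; apply.
by lia.
Qed.

Lemma measurable_shell_union (j : nat) : measurable (shell_union j).
Proof. by rewrite /shell_union; case: eqP. Qed.

Lemma shell_sub_union (j : nat) : (j <= K)%N -> shell K C j `<=` shell_union j.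
Proof. by case: j => [|j] jK; rewrite ?shell0 // shellS // => y []. Qed.

Lemma measurable_shell (j : 'I_K.+1) : measurable (shell K C j).
Proof.
case: j => [[|j]] /= jK; first by rewrite shell0; exact: measurable_shell_union.
by rewrite shellS //; apply: measurableD; exact: measurable_shell_union.
Qed.

Lemma shell_disjoint (i j : 'I_K.+1) (y : Y) :
  shell K C i y -> shell K C j y -> i = j.
Proof.
wlog ij : i j / (i < j)%N => [wl|].
  move=> yi yj; case: (ltngtP i j) => [lt|lt|]; first exact: wl.
    exact/esym/wl.
  exact: val_inj.
case: j ij => [[//|j] jK] /= ij yi.
rewrite shellS // => -[_ []].
apply: shell_union_nested (shell_sub_union _ yi) => //; last by rewrite -ltnS.
by rewrite -ltnS ij /= ltnW.
Qed.

Lemma shell_cover (y : Y) : exists j : 'I_K.+1, shell K C j y.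
Proof.
have ex : exists j, `[< shell_union j y >].
  by exists K; apply/asboolP; rewrite /shell_union eqxx.
case: (ex_minnP ex) => j /asboolP yj jmin.
have jK : (j <= K)%N by apply: jmin; apply/asboolP; rewrite /shell_union eqxx.
exists (Ordinal (jK : (j < K.+1)%N)) => /=.
case: j jK yj jmin => [|j] jK yj jmin; first by rewrite shell0.
by rewrite shellS //; split=> // /asboolP /jmin; rewrite ltnn.
Qed.

Lemma indic_shell (i j : 'I_K.+1) (y : Y) : shell K C i y ->
  \1_(shell K C j) y = (i == j)%:R :> R.
Proof.
move=> yi; rewrite indicE; congr (_%:R); congr nat_of_bool.
apply/idP/eqP => [|<-]; last by rewrite inE.
by rewrite inE; exact: shell_disjoint.
Qed.

Lemma shell_empty (j : 'I_K.+1) :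
  j \notin nonempty_shell K C -> shell K C j = set0.
Proof.
by move=> /asboolPn jN; apply/seteqP; split=> // y yj; case: jN; exists y.
Qed.

Section Masses.
Variable Q : probability Y R.

Definition shell_mass (j : nat) : R := fine (Q (shell K C j)).
Definition shell_union_mass (j : nat) : R := fine (Q (shell_union j)).

Lemma shell_mass_ge0 j : 0 <= shell_mass j.
Proof. exact: fine_ge0. Qed.

Lemma shell_union_massE j : Q (shell_union j) = (shell_union_mass j)%:E.
Proof. by rewrite fineK // fin_num_measure //; exact: measurable_shell_union. Qed.

Lemma shell_massS (j : nat) : (j < K)%N ->
  shell_mass j.+1 = shell_union_mass j.+1 - shell_union_mass j.
Proof.
move=> jK; rewrite /shell_mass shellS // measureD;
  try exact: measurable_shell_union; last first.
  by rewrite ltey_eq fin_num_measure //; exact: measurable_shell_union.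
rewrite setIC setIidl; last by apply: shell_union_nested; rewrite leqnSn.
by rewrite fineB // fin_num_measure //; exact: measurable_shell_union.
Qed.

Lemma shell_union_massK : shell_union_mass K = 1.
Proof. by rewrite /shell_union_mass /shell_union eqxx probability_setT. Qed.

Lemma sum_shell_mass_from (i : nat) : (i <= K)%N ->
  \sum_(i <= j < K) shell_mass j.+1 = 1 - shell_union_mass i.
Proof.
move=> iK; rewrite -shell_union_massK -(telescope_sumr _ iK).
by apply: eq_big_nat => j /andP[_ jK]; exact: shell_massS.
Qed.

Lemma sum_shell_mass : \sum_(j < K.+1) shell_mass j = 1.
Proof.
rewrite big_ord_recl -(big_mkord xpredT (fun j => shell_mass j.+1)).
rewrite sum_shell_mass_from // /shell_mass shell0 -/(shell_union_mass 0).
by rewrite addrC subrK.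
Qed.

Lemma sum_nonempty_shell_mass (g : nat -> R) :
  \sum_(j in nonempty_shell K C) g j * shell_mass j
  = \sum_(j < K.+1) g j * shell_mass j.
Proof.
rewrite [RHS](bigID (mem (nonempty_shell K C))) /= [X in _ + X]big1 ?addr0 //.
move=> j jN.
by rewrite /shell_mass shell_empty // measure0 mulr0.
Qed.

(** The k-th miscoverage is the total mass of the shells j > K - k, and the
    penalty of shell j collects exactly the levels k with j > K - k. *)
Lemma weighted_miscoverage (gamma w : nat -> R) :
  (\sum_(1 <= k < K.+1) (w k / gamma k)%:E * (1 - Q (C k)))%E
  = (\sum_(j in nonempty_shell K C) penalty K gamma w j * shell_mass j)%:E.
Proof.
rewrite sum_nonempty_shell_mass big_ord_recl /penalty subn0 addn1.
rewrite [X in X * shell_mass _]big_geq // mul0r add0r.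
pose a k := w k / gamma k.
transitivity ((\sum_(1 <= k < K.+1) \sum_(0 <= j < K | (K - k <= j)%N)
    a k * shell_mass j.+1)%:E).
  rewrite -sumEFin; apply: eq_big_nat => k /andP[k0 kK].
  have -> : C k = shell_union (K - k).
    by rewrite /shell_union subKn //; case: eqP => // e; exfalso; lia.
  rewrite shell_union_massE -EFinB -EFinM -mulr_sumr.
  rewrite -sum_shell_mass_from ?leq_subr //.
  by congr (_ * _)%:E; rewrite [LHS](big_nat_widenl _ 0).
congr EFin; rewrite (exchange_big_dep_nat xpredT) //=.
rewrite -(big_mkord xpredT
  (fun j => (\sum_(K - j.+1 + 1 <= k < K.+1) a k) * shell_mass j.+1)).
apply: eq_big_nat => j /andP[_ jK].
rewrite mulr_suml [RHS](big_nat_widenl _ 1) ?addn1 //.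
by rewrite big_nat_cond [RHS]big_nat_cond; apply: eq_bigl => k; lia.
Qed.

End Masses.
End Shells.

(** * Conformal sets are nested and measurable *)

Section ConformalSetLemmas.
Context {R : realType} {X Y : Type} {n : nat}.
Variables (s : X * Y -> R) (D : n.-tuple (X * Y)).

Lemma conformal_rank_gt0 (g : R) : g < 1 -> (0 < conformal_rank (n := n) g)%N.
Proof.
move=> g1; rewrite absz_gt0 gt_eqF // ceil_gt0.
by rewrite mulr_gt0 ?ltr0n // subr_gt0.
Qed.

Lemma conformal_rank_antitone (g g' : R) : g <= g' -> g' < 1 ->
  (conformal_rank (n := n) g' <= conformal_rank (n := n) g)%N.
Proof.
move=> gg' g'1; have g1 := le_lt_trans gg' g'1.
have pos (u : R) : u < 1 -> 0 <= n.+1%:R * (1 - u).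
  by move=> u1; rewrite mulr_ge0 // subr_ge0 ltW.
rewrite /conformal_rank -lez_nat.
rewrite !gez0_abs ?ceil_ge0 ?(lt_le_trans (ltrN10 _)) ?pos //.
by apply: le_ceil; rewrite ler_pM2l ?ltr0n // lerD2l lerN2.
Qed.

Lemma conformal_quantile_antitone (g g' : R) : g <= g' -> g' < 1 ->
  (conformal_quantile s D g' <= conformal_quantile s D g)%E.
Proof.
move=> gg' g'1; rewrite /conformal_quantile.
have rk := conformal_rank_antitone gg' g'1.
have r0 := conformal_rank_gt0 (le_lt_trans gg' g'1).
have r0' := conformal_rank_gt0 g'1.
case: (leqP (conformal_rank (n := n) g) n) => [rn|_]; last exact: leey.
rewrite (leq_trans rk rn) lee_fin.
apply: le_sorted_leq_nth; rewrite ?inE ?size_sort ?size_map ?size_tuple; try lia.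
exact: (sort_sorted (@le_total _ _)).
Qed.

Lemma conformal_set_antitone (x : X) (g g' : R) : g <= g' -> g' < 1 ->
  conformal_set s D g' x `<=` conformal_set s D g x.
Proof. by move=> gg' g'1 y /le_trans; apply; exact: conformal_quantile_antitone. Qed.

End ConformalSetLemmas.

Lemma measurable_conformal_set (R : realType) (dX dY : measure_display)
    (X : measurableType dX) (Y : measurableType dY) (n : nat)
    (s : X * Y -> R) (D : n.-tuple (X * Y)) (g : R) (x : X) :
  measurable_fun [set: X * Y] s -> measurable (conformal_set s D g x).
Proof.
move=> ms; rewrite -[conformal_set _ _ _ _]setTI; apply: measurable_lee => //.
by apply/measurable_EFinP; exact: measurable_fun_pair2.
Qed.

(** * Reduction of the robust risk to the linear program *)

Section TwoPointReduction.
Context {R : realType} {d : measure_display} {Y : measurableType d}.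
Variables (alpha : R) (K : nat) (gamma w : nat -> R) (C : nat -> set Y).
Hypothesis K_gt0 : (0 < K)%N.
Hypothesis C_nested : forall k, (1 <= k < K)%N -> C k.+1 `<=` C k.
Hypothesis C_measurable : forall k, measurable (C k).
Variable f : Y -> R.
Hypothesis f_measurable : measurable_fun [set: Y] f.
Hypothesis loss_finite : forall j, j \in nonempty_shell K C ->
  (regional_loss K C f j < +oo)%E.

Let J := nonempty_shell K C.
Let loss (j : 'I_K.+1) : R := fine (regional_loss K C f j).

Lemma regional_lossE (j : 'I_K.+1) : j \in J -> regional_loss K C f j = (loss j)%:E.
Proof.
move=> jJ; rewrite fineK // fin_real // loss_finite // andbT.
have /asboolP[y yj] := jJ; apply: lt_le_trans (ltNyr (f y)) _.
by apply: ereal_sup_ubound; exists y.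
Qed.

Lemma le_loss (j : 'I_K.+1) (y : Y) : shell K C j y -> f y <= loss j.
Proof.
move=> yj; have jJ : j \in J by apply/asboolP; exists y.
by rewrite -lee_fin -regional_lossE //; apply: ereal_sup_ubound; exists y.
Qed.

(** Regional losses over nonempty shells are real numbers, so optimality can be
    discussed in R. *)
Lemma lp_objectiveE (p : 'I_K.+1 -> R) :
  lp_objective K C f p = (\sum_(j in J) p j * loss j)%:E.
Proof.
by rewrite -sumEFin; apply: eq_bigr => j jJ; rewrite regional_lossE // EFinM.
Qed.

Lemma shell_mass_feasible (Q : probability Y R) :
  ambiguity_set alpha K gamma w C Q ->
  lp_feasible alpha K gamma w C (fun j => shell_mass K C Q j).
Proof.
rewrite /ambiguity_set /= weighted_miscoverage // lee_fin => QB; split=> //.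
  by move=> j _; exact: shell_mass_ge0.
rewrite -(sum_shell_mass K_gt0 C_nested C_measurable Q).
have := sum_nonempty_shell_mass K C Q (fun=> 1).
under eq_bigr do rewrite mul1r.
by under [X in _ = X]eq_bigr do rewrite mul1r.
Qed.

(** The cost lies below the step function equal to the regional loss on each
    shell, and this step function integrates to the right-hand side. *)
Lemma expected_cost_le_shells (Q : probability Y R) :
  (expected_cost f Q <= (\sum_(j in J) shell_mass K C Q j * loss j)%:E)%E.
Proof.
pose g (y : Y) := \sum_(j in J) loss j * \1_(shell K C j) y.
have mI (j : 'I_K.+1) :
    measurable_fun [set: Y] (fun y => loss j * \1_(shell K C j) y).
  by apply: measurable_funM => //; apply: measurable_indic; exact: measurable_shell.
have fg y : f y <= g y.
  have [i yi] := shell_cover C K_gt0 y.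
  have iJ : i \in J by apply/asboolP; exists y.
  rewrite /g (bigD1 i) //= big1 => [|j /andP[_ ji]].
    by rewrite addr0 (indic_shell K_gt0 C_nested i yi) // eqxx mulr1 le_loss.
  by rewrite (indic_shell K_gt0 C_nested j yi) // eq_sym (negPf ji) mulr0.
have mg : measurable_fun [set: Y] g.
  rewrite /g; under [X in measurable_fun _ X]eq_fun do rewrite -big_filter.
  exact: measurable_sum.
apply: le_trans (le_integral_measurable Q f_measurable mg fg) _.
have iI (j : 'I_K.+1) : Q.-integrable [set: Y] (fun y => (\1_(shell K C j) y)%:E).
  by apply: integrable_indic => //; exact: measurable_shell.
under eq_integral do rewrite /g -sumEFin.
rewrite integral_sum // => [|j].
  rewrite -sumEFin; apply: lee_sum => j _.
  under eq_integral do rewrite EFinM.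
  rewrite integralZl // integral_indic ?setIT //; last exact: measurable_shell.
  rewrite mulrC EFinM /shell_mass [X in (_ <= _ * X)%E]fineK //.
  by rewrite fin_num_measure //; exact: measurable_shell.
under eq_fun do rewrite EFinM.
exact: integrableZl.
Qed.

(** Placing mass p j at a point of shell j gives a law whose shell masses are the
    p j, hence one satisfying the ambiguity constraint. *)
Lemma law_of_selection (p : 'I_K.+1 -> R) (y : 'I_K.+1 -> Y) :
  lp_feasible alpha K gamma w C p ->
  (forall j, j \in J -> shell K C j (y j)) ->
  exists Q : probability Y R,
    [/\ ambiguity_set alpha K gamma w C Q,
        expected_cost f Q = (\sum_(j in J) p j * f (y j))%:E
      & one_outcome_per_active_shell K C p Q].
Proof.
move=> [p0 p1 pB] yJ.
(* Feasibility says nothing about p on empty shells, so p is cut off there. *)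
pose r j := if j \in J then p j else 0.
have r0 j : 0 <= r j by rewrite /r; case: ifP => // /p0.
have r1 : \sum_j r j = 1 by rewrite -big_mkcond.
have [Q [QE Qint]] := finitely_supported_law y r0 r1.
have sumr (g : 'I_K.+1 -> R) : \sum_j r j * g j = \sum_(j in J) p j * g j.
  rewrite [RHS]big_mkcond; apply: eq_bigr => j _.
  by rewrite /r; case: ifP => // _; rewrite mul0r.
have massE j : j \in J -> shell_mass K C Q j = p j.
  move=> jJ; rewrite /shell_mass QE /= sumr (bigD1 j) //= big1 => [|i /andP[iJ ij]].
    by rewrite (indic_shell K_gt0 C_nested j (yJ _ jJ)) // eqxx mulr1 addr0.
  by rewrite (indic_shell K_gt0 C_nested j (yJ _ iJ)) // (negPf ij) mulr0.
exists Q; split.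
- rewrite /ambiguity_set /= weighted_miscoverage // lee_fin.
  by under eq_bigr => j jJ do rewrite massE //.
- by rewrite /expected_cost Qint // sumr.
- exists y; split=> [j /andP[jJ _]|j /andP[jJ pj]|]; first exact: yJ.
  + rewrite QE lte_fin (bigD1 j) //= indicE mem_set // mulr1.
    rewrite ltr_wpDr //; last by rewrite /r jJ.
    by apply: sumr_ge0 => i _; rewrite mulr_ge0 // indicE.
  + rewrite QE -r1; congr EFin; apply: eq_bigr => j _.
    rewrite indicE; case: (boolP (j \in active_shell K C p)) => jA.
      by rewrite mem_set ?mulr1 //; exists j.
    suff -> : r j = 0 by rewrite mul0r.
    rewrite /r; case: ifP => // jJ; apply/eqP; rewrite eq_le p0 // andbT leNgt.
    by apply: contra jA => pj; rewrite unfold_in jJ.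
Qed.

Lemma law_near_objective (p : 'I_K.+1 -> R) (eps : R) :
  lp_feasible alpha K gamma w C p -> 0 < eps ->
  exists Q : probability Y R,
    [/\ ambiguity_set alpha K gamma w C Q,
        (lp_objective K C f p - eps%:E <= expected_cost f Q)%E
      & one_outcome_per_active_shell K C p Q].
Proof.
move=> pF eps0.
have near (j : 'I_K.+1) : exists y, j \in J -> shell K C j y /\ loss j - eps <= f y.
  case: (boolP (j \in J)) => jJ; last by exists point.
  have : (regional_loss K C f j \is a fin_num) by rewrite regional_lossE.
  move=> /(ub_ereal_sup_adherent eps0)[_ [y yj <-]].
  rewrite -/(regional_loss K C f j) regional_lossE // -EFinB lte_fin => /ltW.
  by exists y.
have [y yJ] := choice near.
have [Q [QA Qf Qp]] := law_of_selection pF (fun j jJ => (yJ j jJ).1).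
exists Q; split=> //; rewrite Qf lp_objectiveE -EFinB lee_fin.
case: pF => p0 p1 _.
rewrite -[eps]mul1r -p1 mulr_suml -sumrB; apply: ler_sum => j jJ.
by rewrite -mulrBr ler_wpM2l ?p0 // (yJ j jJ).2.
Qed.

(** The unit mass on i0 is feasible, so the maximum is over a nonempty set; for
    conformal sets i0 is the innermost shell, whose penalty is 0. *)
Lemma robust_risk_lp (i0 : 'I_K.+1) :
  i0 \in J -> penalty K gamma w i0 <= 1 / alpha ->
  let risk := robust_risk alpha K gamma w C f in
  is_maximum [set lp_objective K C f p | p in lp_feasible alpha K gamma w C] risk
  /\
  exists p : 'I_K.+1 -> R,
    [/\ lp_optimal alpha K gamma w C f p,
        (#|active_shell K C p| <= 2)%N,
        regional_losses_attained K C f ->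
          exists Q : probability Y R,
            [/\ ambiguity_set alpha K gamma w C Q,
                expected_cost f Q = risk
              & one_outcome_per_active_shell K C p Q]
      & forall eps : R, 0 < eps ->
          exists Q : probability Y R,
            [/\ ambiguity_set alpha K gamma w C Q,
                (risk - eps%:E <= expected_cost f Q)%E
              & one_outcome_per_active_shell K C p Q]].
Proof.
move=> i0J hi0 risk.
have [p [pF pmax p2]] := @knapsack_two_point_optimum R _ J
  (fun j => penalty K gamma w j) loss _ i0 i0J hi0.
have popt q : lp_feasible alpha K gamma w C q ->
    (lp_objective K C f q <= lp_objective K C f p)%E.
  by move=> qF; rewrite !lp_objectiveE lee_fin; exact: pmax.
have riskE : risk = lp_objective K C f p.
  apply/eqP; rewrite eq_le; apply/andP; split.
    apply: ge_ereal_sup => _ [Q QA <-].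
    apply: le_trans (expected_cost_le_shells Q) _.
    by rewrite -lp_objectiveE; apply: popt; exact: shell_mass_feasible.
  apply/lee_addgt0Pr => eps eps0; rewrite -leeBlDr //.
  have [Q [QA Qf _]] := law_near_objective pF eps0.
  by apply: le_trans Qf _; apply: ereal_sup_ubound; exists Q.
split.
  by rewrite riskE; split=> [|_ [q qF <-]]; [exists p|exact: popt].
exists p; split=> // [att|eps eps0].
- have sel (j : 'I_K.+1) : exists y, j \in J -> shell K C j y /\ f y = loss j.
    case: (boolP (j \in J)) => jJ; last by exists point.
    by have [y yj] := att j jJ; rewrite regional_lossE // => -[fy]; exists y.
  have [y yJ] := choice sel.
  have [Q [QA Qf Qp]] := law_of_selection pF (fun j jJ => (yJ j jJ).1).
  exists Q; split=> //; rewrite Qf riskE lp_objectiveE; congr EFin.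
  by apply: eq_bigr => j jJ; rewrite (yJ j jJ).2.
- by rewrite riskE; exact: law_near_objective.
Qed.

End TwoPointReduction.

Theorem theorem2 (R : realType) (dX dY : measure_display)
    (X : measurableType dX) (Y : measurableType dY)
    (hX : standard_borel R X) (hY : standard_borel R Y)
    (Zt : Type) (Z : X -> set Zt) (c : Zt -> Y -> R)
    (hc : forall z, measurable_fun [set: Y] (c z))
    (alpha : R) (halpha : 0 < alpha < 1)
    (n : nat) (D : n.-tuple (X * Y))
    (s : X * Y -> R) (hs : measurable_fun [set: X * Y] s)
    (Gamma : set R) (hGamma : Gamma `<=` [set g | 0 < g < alpha])
    (K : nat) (gamma w : nat -> R) (hnu : aggregation_rule Gamma K gamma w)
    (hinner : forall x : X, conformal_set s D (gamma K) x !=set0)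
    (hfin : forall (x : X) (z : Zt), Z x z ->
      forall j, j \in nonempty_shell K (conformal_region s D gamma x) ->
        (regional_loss K (conformal_region s D gamma x) (c z) j < +oo)%E)
    (x : X) (z : Zt) (hz : Z x z) :
  let C := conformal_region s D gamma x in
  let risk := robust_risk alpha K gamma w C (c z) in
  is_maximum
    [set lp_objective K C (c z) p | p in lp_feasible alpha K gamma w C] risk
  /\
  exists p : 'I_K.+1 -> R,
    [/\ lp_optimal alpha K gamma w C (c z) p,
        (#|active_shell K C p| <= 2)%N,
        regional_losses_attained K C (c z) ->
          exists Q : probability Y R,
            [/\ ambiguity_set alpha K gamma w C Q,
                expected_cost (c z) Q = risk
              & one_outcome_per_active_shell K C p Q]
      & forall eps : R, 0 < eps ->
          exists Q : probability Y R,
            [/\ ambiguity_set alpha K gamma w C Q,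
                (risk - eps%:E <= expected_cost (c z) Q)%E
              & one_outcome_per_active_shell K C p Q]].
Proof.
move=> C risk.
have [Gk gamma_lt _ w1] := hnu.
have K_gt0 : (0 < K)%N.
  rewrite lt0n; apply: contra_eq_neq w1 => ->.
  by rewrite big_geq // eq_sym oner_eq0.
have /andP[alpha0 alpha1] := halpha.
apply: (@robust_risk_lp _ _ _ _ _ _ _ _ K_gt0 _ _ _ (hc z) _ ord0).
- move=> k /andP[k0 kK]; apply: conformal_set_antitone.
    by rewrite ltW // gamma_lt // k0.
  have /hGamma/andP[_ ga] := Gk k.+1 kK.
  exact: lt_trans ga alpha1.
- by move=> k; exact: measurable_conformal_set.
- by move=> j; exact: hfin.
- by apply/asboolP; exact: hinner.
- by rewrite /penalty subn0 addn1 big_geq // divr_ge0 // ltW.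
Qed.
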